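(* Let $X$ be a locally compact Hausdorff space and let $V$ be a non-trivial metrizable topological vector space (over $\mathbb R$ or $\mathbb C$). If $X$ contains a regular closed, $\sigma$-compact, non-compact subset, then the following are equivalent: (i) the family $\{C_K(X,V)\}_{K\in\mathscr{K}(X)}$ satisfies ACP; (ii) $X$ is homeomorphic to $\mathbb N$ with the discrete topology and $V$ is finite dimensional.
   Context: A subset is regular closed if it equals the closure of its interior. $\mathscr K(X)$ is the set of compact subsets of $X$, ordered by inclusion. $C_K(X,V)$ is the group (under pointwise addition) of continuous $f\colon X\to V$ whose support $\operatorname{cl}_X\{x\mid f(x)\neq 0\}$ is contained in $K$, with the topology of uniform convergence; the family has inclusions as bonding maps. For a directed family $\{G_\alpha\}$ of topological groups with inclusions that are closed embeddings as bonding maps and union $G$, the colimit space topology is $\mathscr T=\{U\subseteq G\mid U\cap G_\alpha\text{ open in }G_\alpha\ \forall\alpha\}$; the family satisfies ACP if $(G,\mathscr T)$ is a topological group (equivalently, $\mathscr T$ equals the finest group topology making all inclusions continuous). *)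

(* Defs.v *)
From HB Require Import structures.
From mathcomp Require Import all_boot all_order all_algebra.
From mathcomp Require Import all_classical all_reals all_analysis.
From mathcomp Require Export complex.
Set Implicit Arguments. Unset Strict Implicit. Unset Printing Implicit Defensive.
Import Order.TTheory GRing.Theory Num.Theory.
Local Open Scope classical_set_scope.
Local Open Scope ring_scope.

Definition regular_closed (X : topologicalType) (A : set X) : Prop :=
  A = closure (interior A).

Definition sigma_compact (X : topologicalType) (A : set X) : Prop :=
  exists Kn : nat -> set X, (forall n, compact (Kn n)) /\ A = \bigcup_n Kn n.

(** X is homeomorphic to N with the discrete topology
   (the topology of [nat] in MathComp-Analysis is the discrete one). *)
Definition homeomorphic_to_discrete_nat (X : topologicalType) : Prop :=
  exists (f : X -> nat) (g : nat -> X),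
    cancel f g /\ cancel g f /\ continuous f /\ continuous g.

Definition metrizable (R : realType) (T : topologicalType) : Prop :=
  exists d : T -> T -> R,
    (forall x y, d x y = 0 <-> x = y) /\
    (forall x y, d x y = d y x) /\
    (forall x y z, d x z <= d x y + d y z) /\
    (forall A : set T, open A <->
       (forall x, A x -> exists e : R, 0 < e /\ [set y | d x y < e] `<=` A)).

Definition finite_dimensional (K : numDomainType) (V : lmodType K) : Prop :=
  exists s : seq V, forall v : V,
    exists c : 'I_(size s) -> K, v = \sum_(i < size s) c i *: s`_i.

Section CK.
Variables (X : topologicalType) (V : topologicalZmodType).

Definition fsupport (f : X -> V) : set X := closure [set x | f x != 0].

Definition C_K (K : set X) : set (X -> V) :=
  [set f | continuous f /\ fsupport f `<=` K].

Definition C_union : set (X -> V) :=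
  [set f | exists K : set X, compact K /\ C_K K f].

(** open sets of S (a set of functions) for the topology of uniform
    convergence (the uniformity of the topological group V):
    W is open in S iff W is a subset of S and around each f in W there is
    a 0-neighbourhood U of V with {g in S | forall x, g x - f x \in U} in W. *)
Definition unif_open (S W : set (X -> V)) : Prop :=
  W `<=` S /\
  forall f, W f -> exists U : set V, nbhs (0 : V) U /\
    [set g | S g /\ forall x, U (g x - f x)] `<=` W.

Definition colim_open (W : set (X -> V)) : Prop :=
  W `<=` C_union /\
  forall K : set X, compact K -> unif_open (C_K K) (W `&` C_K K).

(** ACP: (G, colimit topology) is a topological group, i.e. addition
    G x G -> G is continuous (for the product topology) and inversion
    G -> G is continuous. *)
Definition ACP : Prop :=
  (forall f g, C_union f -> C_union g ->
     forall W, colim_open W -> W (f + g) ->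
       exists A B, [/\ colim_open A, colim_open B, A f, B g &
                       forall a b, A a -> B b -> W (a + b)]) /\
  (forall W, colim_open W -> colim_open [set f | C_union f /\ W (- f)]).

End CK.

(* Main.v *)
Require Import Defs.
From HB Require Import structures.
From mathcomp Require Import all_boot all_order all_algebra.
From mathcomp Require Import all_classical all_reals all_analysis.
From mathcomp Require Import complex.
Import Order.TTheory GRing.Theory Num.Theory.
Import numFieldNormedType.Exports.
Local Open Scope classical_set_scope.
Local Open Scope ring_scope.
Set Implicit Arguments. Unset Strict Implicit. Unset Printing Implicit Defensive.

(* ACP is refuted by exhibiting a subset of the colimit that is closed,
   misses 0, and yet meets A + A for every neighbourhood A of 0.  Let K0 be a
   compact set such that no neighbourhood of 0 in C_{K0}(X, V) is totally
   bounded: this happens if V is infinite dimensional (Riesz) or if X has a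
   non-isolated point.  A regular closed, sigma-compact, non-compact set
   provides bumps phi_k leaving every compact set, and the witness consists of
   the functions Y_kj + phi_k v / (j + 1), where (Y_kj)_j is a uniformly
   separated sequence in the k-th neighbourhood of 0 in C_{K0}(X, V), as in
   Yamasaki's theorem on countable colimits.  If X is discrete and uncountable,
   the witness consists of the functions w_c(a,b) (delta_a + delta_b), with
   w_n --> 0 and a coloring c of pairs that is unbounded on every uncountable
   set.  Conversely, if X is discrete and countable and V is locally compact,
   boxes form a base of neighbourhoods of 0 for the colimit topology. *)

(** * Scalars *)

(* All that the proof needs to know about the two scalar fields. *)
Definition scalar_embedding (R : realType) (K : numFieldType)
    (iota : {rmorphism R -> K}) : Prop :=
  [/\ continuous (iota : R -> K^o), forall t, `|iota t| = iota `|t|,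
      forall t u, (iota t <= iota u) = (t <= u) &
      compact [set c : K^o | `|c| <= 1]].

Lemma scalar_embedding_real (R : realType) :
  scalar_embedding (idfun : {rmorphism R -> R}).
Proof.
split => //; first by move=> x; exact: cvg_id.
have E : [set c : R^o | `|c| <= 1] = (`[-1, 1]%classic : set R).
  by apply/seteqP; split => x /=; rewrite ler_norml in_itv.
by rewrite [X in compact X]E; exact: segment_compact.
Qed.

Lemma scalar_embedding_complex (R : realType) :
  scalar_embedding (@real_complex R : {rmorphism R -> complex R}).
Proof.
have normC (t : R) : `|t%:C%C| = `|t|%:C%C.
  by rewrite normc_def /= expr0n /= addr0 sqrtr_sqr.
have ctsC : continuous (@real_complex R : R -> (complex R)^o).
  move=> x; apply/cvgrPdist_lt => -[e e'] /[dup]; rewrite {1}ltcE /= => /andP[/eqP/= -> e0 _].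
  near=> y; rewrite -rmorphB normC ltcR.
  by near: y; apply: cvgr_dist_lt => //; exact: cvg_id.
split => //; first by move=> t u; rewrite lecR.
(* Compactness is imported from [R * R]: the unit disc is the image under the continuous [f] of [D],
   a closed part of the square [-1, 1]^2. *)
pose D := [set p : R * R | p.1 ^+ 2 + p.2 ^+ 2 <= 1].
pose f (p : R * R) : (complex R)^o := p.1%:C%C + 'i%C * p.2%:C%C.
have -> : [set c : (complex R)^o | `|c| <= 1] = f @` D.
  apply/seteqP; split => [[a b]|_ [[a b] Dab <-]] /=.
    rewrite normc_def lecR /= => ab1; exists (a, b).
      rewrite /D /= -[leLHS]sqr_sqrtr ?addr_ge0 ?sqr_ge0//.
      by rewrite expr_le1// sqrtr_ge0.
    by rewrite /f /=; simpc.
  rewrite /f /= (_ : a%:C%C + _ = (a +i* b)%C); last first.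
    by simpc.
  by rewrite normc_def /= lecR -(sqrtr1 R) ler_wsqrtr.
apply: continuous_compact; last first.
  have cB : compact ((`[-1, 1]%classic `*` `[-1, 1]%classic) : set (R * R)).
    by apply: compact_setX; exact: segment_compact.
  apply: (subclosed_compact _ cB).
  - rewrite (_ : D = (fun p : R * R => p.1 ^+ 2 + p.2 ^+ 2) @^-1` [set x | x <= 1])//.
    apply: closed_comp; last exact: closed_le.
    move=> p _; apply: cvgD; apply: cvgM; by [exact: cvg_fst|exact: cvg_snd].
  - move=> [a b]; rewrite /D /= => ab1.
    by split; rewrite /= in_itv /= -ler_norml -(@expr_le1 _ 2)// real_normK ?num_real//;
      apply: le_trans ab1; rewrite ?lerDl ?lerDr sqr_ge0.
apply: continuous_subspaceT => p.
apply: (@cvgD _ (complex R)^o).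
  by apply: continuous_comp; [exact: cvg_fst|exact: ctsC].
apply: (@cvgMr _ _ _ _ _ ('i%C : (complex R)^o)).
by apply: continuous_comp; [exact: cvg_snd|exact: ctsC].
Unshelve. all: by end_near. Qed.

(** * Topological vector spaces *)

Lemma near0_addsub (V : topologicalZmodType) (U : set V) : nbhs 0 U ->
  exists2 W, nbhs 0 W & forall a b, W a -> W b -> U (a + b) /\ U (a - b).
Proof.
move=> U0; have [[A B] [/= A0 B0] AB] : nbhs ((0, 0) : V * V) [set p | U (p.1 + p.2)].
  by apply: (add_continuous (0, 0)); rewrite /= addr0.
have [[C D] [/= C0 D0] CD] : nbhs ((0, 0) : V * V) [set p | U (p.1 - p.2)].
  by apply: (@tvs.sub_continuous V (0, 0)); rewrite /= subr0.
exists ((A `&` B) `&` (C `&` D)); first by apply: filterI; apply: filterI.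
by move=> a b [[Aa _] [Ca _]] [[_ Bb] [_ Db]]; split; [exact: (AB (a, b))|exact: (CD (a, b))].
Qed.

Lemma nbhs_translate (V : topologicalZmodType) (x : V) (A : set V) :
  nbhs x A <-> nbhs 0 [set v | A (x + v)].
Proof.
split => xA.
  have : nbhs ((x, 0) : V * V) [set p | A (p.1 + p.2)].
    by apply: (add_continuous (x, 0)); rewrite /= addr0.
  move=> [[B C] [/= Bx C0] BC]; apply: filterS C0 => v Cv.
  by apply: (BC (x, v)); split => //=; exact: nbhs_singleton.
have : nbhs ((x, x) : V * V) [set p | A (x + (p.1 - p.2))].
  by apply: (@tvs.sub_continuous V (x, x) [set v | A (x + v)]); rewrite /= subrr.
move=> [[B C] [/= Bx Cx] BC]; apply: filterS Bx => v Bv.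
have := BC (v, x); rewrite /= [v - x]addrC addNKr; apply.
by split => //=; exact: nbhs_singleton.
Qed.

Lemma near_scale (K : numFieldType) (V : topologicalLmodType K) (c : K) (v : V)
    (A : set V) : nbhs (c *: v) A ->
  exists d, exists W, [/\ 0 < d, nbhs v W &
    forall c' v', `|c' - c| < d -> W v' -> A (c' *: v')].
Proof.
move=> cvA; have : nbhs ((c, v) : K^o * V) [set p | A (p.1 *: p.2)].
  by apply: (scale_continuous (c, v)).
move=> [[B C] [/= /nbhs_ballP[d /= d0 dB] Cv] BC]; exists d, C; split => // c' v' dc Cv'.
by apply: (BC (c', v')); split => //; apply: dB; rewrite -ball_normE /= distrC.
Qed.

Lemma near0_scale (K : numFieldType) (V : topologicalLmodType K) (c : K)
  (U : set V) : nbhs 0 U -> nbhs 0 [set v | U (c *: v)].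
Proof.
move=> U0; have : nbhs (c *: (0 : V)) U by rewrite scaler0.
move=> /near_scale[d [W [d0 W0 dW]]]; apply: filterS W0 => v Wv.
by apply: dW; rewrite ?subrr ?normr0.
Qed.

Lemma near0_absorbs_point (K : numFieldType) (V : topologicalLmodType K) (v : V)
    (U : set V) : nbhs 0 U ->
  exists2 d : K, 0 < d & forall c, `|c| < d -> U (c *: v).
Proof.
move=> U0; have : nbhs ((0 : K) *: v) U by rewrite scale0r.
move=> /near_scale[d [W [d0 Wv dW]]]; exists d => // c dc.
by apply: dW; [rewrite subr0|exact: nbhs_singleton].
Qed.

Lemma near0_balanced (K : numFieldType) (V : topologicalLmodType K)
    (U : set V) : nbhs 0 U ->
  exists W, [/\ nbhs 0 W, W `<=` U &
    forall c v, `|c| <= 1 -> W v -> W (c *: v)].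
Proof.
move=> U0; have : nbhs ((0 : K) *: (0 : V)) U by rewrite scale0r.
move=> /near_scale[d [N [d0 N0 dN]]].
exists [set w | exists c v, [/\ `|c| < d, N v & w = c *: v]]; split.
- have d20 : d / 2 != 0 by rewrite gt_eqF// divr_gt0.
  apply: filterS (near0_scale (d / 2)^-1 N0) => v Nv.
  exists (d / 2), ((d / 2)^-1 *: v); split => //; last by rewrite scalerA divff ?scale1r.
  by rewrite gtr0_norm ?divr_gt0// ltr_pdivrMr// ltr_pMr// ltr1n.
- by move=> _ [c [v [dc Nv ->]]]; apply: dN; rewrite ?subr0.
- move=> c _ c1 [c' [v [dc Nv ->]]]; exists (c * c'), v; split => //.
    by rewrite normrM (le_lt_trans _ dc)// ler_piMl.
  by rewrite scalerA.
Qed.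

(** Scaling sends a product neighbourhood of (0, v) into [U]; the near-covering form of compactness
    makes the scalar radius uniform over [B]. *)
Lemma near0_absorbs_compact (K : numFieldType) (V : topologicalLmodType K)
    (B U : set V) : compact B -> nbhs 0 U ->
  exists2 d : K, 0 < d & forall c v, `|c| < d -> B v -> U (c *: v).
Proof.
move=> /compact_near_coveringP cB U0.
have : \forall c \near (0 : K^o), B `<=` (fun v => U (c *: v)).
  apply: (cB K^o (nbhs (0 : K^o)) (fun c v => U (c *: v))) => v Bv.
  have : nbhs ((0 : K) *: v) U by rewrite scale0r.
  move=> /near_scale[d [W [d0 Wv dW]]].
  exists (W, [set c : K^o | `|c| < d]) => /=; last first.
    by move=> [w c] [/= Ww dc]; apply: dW; rewrite ?subr0.
  split => //; apply/nbhs_ballP; exists d => // c.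
  by rewrite -ball_normE /= sub0r normrN.
move=> /nbhs_ballP[d /= d0 dB]; exists d => // c v dc Bv.
by apply: dB Bv; rewrite -ball_normE /= sub0r normrN.
Qed.

(** A point of the closure is scaled into the interior of [U]; there the points of [F] near it lie
    in [B], which is closed. Scaling back stays in [F]. *)
Lemma scaling_closed_of_local_compact (K : numFieldType)
    (V : topologicalLmodType K) (F U B : set V) : hausdorff_space V ->
    (forall c v, F v -> F (c *: v)) -> nbhs 0 U -> compact B -> B `<=` F ->
  U `&` F `<=` B -> closed F.
Proof.
move=> hV FZ U0 cB BF UFB x clFx.
have [d d0 dx] := near0_absorbs_point x (nbhs_interior U0).
have dx_ne0 : d / 2 != 0 by rewrite gt_eqF// divr_gt0.
have Bdx : B ((d / 2) *: x).
  apply: (compact_closed hV cB) => N Nx.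
  have Ux : nbhs ((d / 2) *: x) U.
    by apply: dx; rewrite gtr0_norm ?divr_gt0// ltr_pdivrMr// ltr_pMr// ltr1n.
  have [e [W [e0 Wx eW]]] := near_scale (filterI Nx Ux).
  have [y [Fy Wy]] := clFx _ Wx.
  have [Ny Uy] : (N `&` U) ((d / 2) *: y) by apply: eW; rewrite ?subrr ?normr0.
  by exists ((d / 2) *: y); split => //; apply: UFB; split => //; exact: FZ.
by have := FZ (d / 2)^-1 _ (BF _ Bdx); rewrite scalerA mulVf// scale1r.
Qed.

(** * Spans of finite lists of vectors *)

(** The recursive form lets an induction adjoin one vector at a time; [lin_spanP] recovers the sums
    used in [finite_dimensional]. *)
Fixpoint lin_span (K : numFieldType) (V : lmodType K) (s : seq V) : set V :=
  if s is a :: s' then [set v | exists c f, lin_span s' f /\ v = c *: a + f]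
  else [set 0].

Lemma lin_span0 (K : numFieldType) (V : lmodType K) (s : seq V) : lin_span s 0.
Proof.
by elim: s => //= a s IH; exists 0, 0; split => //; rewrite scale0r addr0.
Qed.

Lemma lin_spanZ (K : numFieldType) (V : lmodType K) (s : seq V) c v :
  lin_span s v -> lin_span s (c *: v).
Proof.
elim: s v => /= [v ->|a s IH _ [b [f [sf ->]]]]; first by rewrite scaler0.
by exists (c * b), (c *: f); split; [exact: IH|rewrite scalerDr scalerA].
Qed.

Lemma lin_spanD (K : numFieldType) (V : lmodType K) (s : seq V) v w :
  lin_span s v -> lin_span s w -> lin_span s (v + w).
Proof.
elim: s v w => /= [v w -> ->|a s IH _ _ [b [f [sf ->]]] [c [g [sg ->]]]].
  by rewrite addr0.
by exists (b + c), (f + g); split; [exact: IH|rewrite scalerDl addrACA].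
Qed.

Lemma mem_lin_span (K : numFieldType) (V : lmodType K) (s : seq V) v :
  v \in s -> lin_span s v.
Proof.
elim: s => //= a s IH; rewrite inE => /predU1P[->|/IH sv].
  by exists 1, 0; split; [exact: lin_span0|rewrite scale1r addr0].
by exists 0, v; split => //; rewrite scale0r add0r.
Qed.

Lemma lin_spanP (K : numFieldType) (V : lmodType K) (s : seq V) v :
  lin_span s v <-> exists c : 'I_(size s) -> K, v = \sum_(i < size s) c i *: s`_i.
Proof.
elim: s v => /= [v|a s IH v].
  split=> [->|[c ->]]; last by rewrite big_ord0.
  by exists (fun=> 0); rewrite big_ord0.
split=> [[b [f [/IH[c ->] ->]]]|[c ->]].
  exists (fun i => oapp c b (unlift ord0 i)).
  rewrite big_ord_recl /= unlift_none; congr (_ + _).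
  by apply: eq_bigr => i _; rewrite liftK.
rewrite big_ord_recl /=; exists (c ord0), (\sum_(i < size s) c (lift ord0 i) *: s`_i).
by split => //; apply/IH; exists (fun i => c (lift ord0 i)).
Qed.
Lemma continuous_add (T : topologicalType) (V : topologicalZmodType)
    (f g : T -> V) : continuous f -> continuous g ->
  continuous (fun x => f x + g x).
Proof.
move=> cf cg x; apply: (@continuous_comp T (V * V)%type V (fun x => (f x, g x))
  (fun q : V * V => q.1 + q.2)); last exact: add_continuous.
by apply: (@cvg_pair _ _ _ _ (nbhs (f x)) (nbhs (g x))); [exact: cf|exact: cg].
Qed.

Lemma continuous_scale (T : topologicalType) (K : numFieldType)
    (V : topologicalLmodType K) (c : T -> K^o) (f : T -> V) :
  continuous c -> continuous f -> continuous (fun x => (c x : K) *: f x).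
Proof.
move=> cc cf x; apply: (@continuous_comp T (K^o * V)%type V (fun x => (c x, f x))
  (fun q : K^o * V => q.1 *: q.2)); last exact: scale_continuous.
by apply: (@cvg_pair _ _ _ _ (nbhs (c x)) (nbhs (f x))); [exact: cc|exact: cf].
Qed.

(** Induction on the generators. If [a] lies outside the smaller span, which is closed by the
    induction hypothesis, a balanced neighbourhood of 0 translated to [a] misses that span; this
    bounds the coefficient c in c a + f, and then f as well. *)
Lemma lin_span_locally_compact (K : numFieldType) (V : topologicalLmodType K)
    (s : seq V) : hausdorff_space V -> compact [set c : K^o | `|c| <= 1] ->
  exists U B, [/\ nbhs 0 U, compact B, B `<=` lin_span s &
    U `&` lin_span s `<=` B].
Proof.
move=> hV disc; elim: s => [|a s [U [B [U0 cB BF UFB]]]].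
  by exists setT, [set 0]; split; [exact: filterT|exact: compact_set1| |move=> v []].
have Fclosed := scaling_closed_of_local_compact hV (@lin_spanZ _ _ s) U0 cB BF UFB.
have [Fa|nFa] := pselect (lin_span s a).
  exists U, B; split => //.
    by move=> v /BF Fv; exists 0, v; rewrite scale0r add0r.
  move=> v [Uv [c [f [Ff vE]]]]; apply: UFB; split => //; rewrite vE.
  by apply: lin_spanD => //; exact: lin_spanZ.
have : nbhs a (~` lin_span s) 
  by apply: open_nbhs_nbhs; split; [exact: closed_openC|exact: nFa].
move=> /nbhs_translate/near0_balanced[U1 [U10 U1F bal]].
have [U2 U20 U2U] := near0_addsub U0.
have [d d0 da] := near0_absorbs_point a U20.
(* If |c| >= e, balancedness puts - a - f / c in [U1], although adding [a] to it gives - f / c, a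
   point of the span. *)
have small c f e : 0 < e -> lin_span s f -> U1 (e^-1 *: (c *: a + f)) -> `|c| < e.
  move=> e0 Ff Ue; rewrite real_ltNge ?realE ?normr_ge0 ?(ltW e0)//.
  apply/negP => ec; have c0 : c != 0 by rewrite -normr_gt0 (lt_le_trans e0).
  apply: (U1F ((- (e / c)) *: (e^-1 *: (c *: a + f)))).
    apply: bal => //; rewrite normrN normrM normfV gtr0_norm//.
    by rewrite ler_pdivrMr ?normr_gt0// mul1r.
  rewrite scalerA mulNr mulrAC divff ?gt_eqF// mul1r scaleNr scalerDr scalerA.
  by rewrite mulVf// scale1r opprD addNKr -scaleNr; exact: lin_spanZ.
(* [U1] gives |c| <= 1, its dilate by [d] gives |c| < d and hence c a in [U2], and v in [U2] then
   gives f = v - c a in [U]. *)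
exists ([set v | U1 (d^-1 *: v)] `&` (U1 `&` U2)).
exists ((fun p : K^o * V => p.1 *: a + p.2) @` ([set c | `|c| <= 1] `*` B)); split.
- by apply: filterI; [exact: near0_scale|exact: filterI].
- apply: continuous_compact; last exact: compact_setX.
  apply: continuous_subspaceT; apply: continuous_add; last by move=> p; exact: cvg_snd.
  apply: (continuous_scale (c := fun p : K^o * V => p.1)); first by move=> p; exact: cvg_fst.
  by move=> p; exact: cst_continuous.
- by move=> _ [[c f] [/= _ Bf] <-]; have Ff := BF _ Bf; exists c, f.
- move=> v [[Ud [Uv U2v]] [c [f [Ff vE]]]].
  rewrite vE; exists (c, f) => //=; split => /=.
    by apply: ltW; apply: (small c f 1) => //; rewrite invr1 scale1r -vE.
  have cd : `|c| < d by apply: (small c f d) => //; rewrite -vE.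
  apply: UFB; split => //; have [_] := U2U _ _ U2v (da _ cd).
  by rewrite vE addrAC subrr add0r.
Qed.

Lemma lin_span_closed (K : numFieldType) (V : topologicalLmodType K)
    (s : seq V) : hausdorff_space V -> compact [set c : K^o | `|c| <= 1] ->
  closed (lin_span s).
Proof.
move=> hV disc; have [U [B [U0 cB BF UFB]]] := lin_span_locally_compact s hV disc.
exact: (scaling_closed_of_local_compact hV (@lin_spanZ _ _ s) U0 cB BF UFB).
Qed.

Lemma finite_dimensional_locally_compact (K : numFieldType)
    (V : topologicalLmodType K) :
    hausdorff_space V -> compact [set c : K^o | `|c| <= 1] ->
  finite_dimensional V -> exists2 D : set V, nbhs 0 D & compact D.
Proof.
move=> hV disc [s Vs]; have [U [B [U0 cB BF UFB]]] := lin_span_locally_compact s hV disc.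
exists B => //; apply: filterS U0 => v Uv; apply: UFB; split => //.
exact/lin_spanP.
Qed.

Lemma near0_absorbs_seq (K : numFieldType) (V : topologicalLmodType K)
    (s : seq V) (U : set V) : nbhs 0 U ->
  \forall c \near (0 : K^o), forall w, w \in s -> U (c *: w).
Proof.
move=> U0; elim: s => [|a s IH]; first by apply: (@filterE _ (nbhs (0 : K^o))) => c w; rewrite in_nil.
have [d d0 da] := near0_absorbs_point a U0.
have : \forall c \near (0 : K^o), U (c *: a).
  by apply/nbhs_ballP; exists d => // c; rewrite -ball_normE /= sub0r normrN; exact: da.
by move=> sa; apply: (@filterS2 _ (nbhs (0 : K^o)) _ _ _ _ _ IH sa) => c cs ca w; rewrite inE => /predU1P[->|/cs].
Qed.

(** Greedy choice: the state of the iteration is the list of the terms chosen so far, and [g]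
    returns a new term related to all of them. *)
Lemma separated_sequence (T : choiceType) (N : set T) (r : T -> T -> Prop) :
    (forall s : seq T, exists2 v, N v & forall w, w \in s -> r w v) ->
  exists y : nat -> T, (forall j, N (y j)) /\ forall i j, (i < j)%N -> r (y i) (y j).
Proof.
move=> H; have [g gP] : {g : seq T -> T & forall s, N (g s) /\ forall w, w \in s -> r w (g s)}.
  by apply: (@choice _ _ (fun s v => N v /\ forall w, w \in s -> r w v)) => s;
     have [v ? ?] := H s; exists v.
pose S n := iter n (fun s => g s :: s) [::].
exists (fun n => g (S n)); split=> [j|i j ij]; first by have [] := gP (S j).
have [_] := gP (S j); apply; elim: j ij => // j IH.
rewrite ltnS leq_eqVlt /= inE => /predU1P[->|/IH ->]; first by rewrite eqxx.
by rewrite orbT.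
Qed.

(* Riesz's argument: a totally bounded neighbourhood N of 0 satisfies
   N <= F + N / 2 for a finite dimensional F, hence N <= F + N / 2^n for
   every n, and N lies in the closed subspace F. *)
Lemma infinite_dimensional_separated (R : realType) (K : numFieldType)
    (iota : {rmorphism R -> K}) (V : topologicalLmodType K) (N : set V) :
    scalar_embedding iota -> hausdorff_space V -> ~ finite_dimensional V ->
    nbhs 0 N ->
  exists (y : nat -> V) (U : set V), [/\ nbhs 0 U, forall j, N (y j) &
    forall i j, (i < j)%N -> ~ U (y i - y j)].
Proof.
move=> [iotac _ _ disc] hV infV /near0_balanced[{}N' [N0 N'N bal]].
apply: contrapT => nosep; apply: infV.
have TB U : nbhs 0 U ->
    exists s : seq V, forall v, N' v -> exists2 w, w \in s & U (w - v).
  move=> U0; apply: contrapT => noS; apply: nosep.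
  have [|y [Ny yU]] := @separated_sequence V N' (fun w v => ~ U (w - v)); last first.
    by exists y, U; split => // j; exact: N'N.
  move=> s; apply: contrapT => H; apply: noS; exists s => v Nv.
  apply: contrapT => H2; apply: H; exists v => // w ws Uwv; apply: H2.
  by exists w.
have [s sN] := TB _ (near0_scale 2 N0).
(* From v - f in 2^-n N', a finite net of N' modulo N' / 2 improves f and puts the new error in
   2^-(n+1) N'. *)
have approx n v : N' v -> exists2 f, lin_span s f & N' (2 ^+ n *: (v - f)).
  move=> Nv; elim: n => [|n [f Ff Nf]].
    by exists 0; [exact: lin_span0|rewrite expr0 scale1r subr0].
  have [w ws /= Nw] := sN _ Nf; exists (f + (2 ^+ n)^-1 *: w).
    by apply: lin_spanD => //; apply: lin_spanZ; exact: mem_lin_span.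
  have := bal (-1) _ _ Nw; rewrite normrN normr1 => /(_ (lexx _)).
  rewrite scaleN1r -scalerN opprB exprS -scalerA opprD addrA [in X in _ -> X]scalerBr.
  by rewrite scalerA divff ?scale1r// expf_neq0// pnatr_eq0.
(* Total boundedness makes [N'] absorbed by every neighbourhood of 0, so that the errors 2^-n N'
   shrink to 0. *)
have bounded U : nbhs 0 U -> \forall c \near (0 : K^o), forall v, N' v -> U (c *: v).
  move=> /near0_addsub[W /near0_balanced[W' [W'0 W'W Wbal]] WU].
  have [t tN] := TB _ W'0; have small := near0_absorbs_seq t W'0.
  have disc0 : \forall c \near (0 : K^o), `|c| <= 1.
    apply/nbhs_ballP; exists 1 => //= c; rewrite -ball_normE /= sub0r normrN.
    exact: ltW.
  apply: (@filterS2 _ (nbhs (0 : K^o)) _ _ _ _ _ small disc0) => c ct c1 v /tN[w wt Wwv].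
  have [_] := WU _ _ (W'W _ (ct w wt)) (W'W _ (Wbal c _ c1 Wwv)).
  by rewrite scalerBr opprB addrCA subrr addr0.
(* The limit is taken in [R] and carried over by [iota], because a general [numFieldType] need not
   be archimedean. *)
have pow0 : (fun n => (2 ^+ n)^-1 : K^o) @ \oo --> (0 : K^o).
  have -> : (fun n => (2 ^+ n)^-1 : K^o) = iota \o (fun n => 2^-1 ^+ n).
    by apply/funext => n /=; rewrite rmorphXn fmorphV rmorph_nat exprVn.
  rewrite -(rmorph0 iota); apply: continuous_cvg; first exact: iotac.
  by apply: cvg_expr; rewrite ger0_norm// invf_lt1// ltr1n.
have Fclosed := @lin_span_closed K V s hV disc.
have NF v : N' v -> lin_span s v.
  move=> Nv; apply: Fclosed => A /nbhs_translate /bounded /pow0 [n _ nA].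
  have [f Ff Nf] := approx n v Nv; exists f; split => //.
  have := nA n (leqnn n) _ (bal (-1) _ _ Nf); rewrite normrN normr1 => /(_ (lexx _)) /=.
  rewrite scaleN1r scalerN scalerA mulVf ?expf_neq0 ?pnatr_eq0// scale1r.
  by rewrite opprB addrC subrK.
exists s => v; apply/lin_spanP.
have [d d0 dv] := near0_absorbs_point v N0.
have dx_ne0 : d / 2 != 0 by rewrite gt_eqF// divr_gt0.
have /NF/(lin_spanZ (d / 2)^-1) : N' ((d / 2) *: v).
  by apply: dv; rewrite gtr0_norm ?divr_gt0// ltr_pdivrMr// ltr_pMr// ltr1n.
by rewrite scalerA mulVf// scale1r.
Qed.

(** * Failure of ACP *)

Lemma C_K_eq0 (X : topologicalType) (V : topologicalZmodType) (K : set X)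
    (f : X -> V) x : C_K K f -> ~ K x -> f x = 0.
Proof.
move=> [_ fK] nKx; apply: contrapT => /eqP fx0.
by apply/nKx/fK; exact: subset_closure.
Qed.

Lemma C_K_closed (X : topologicalType) (V : topologicalZmodType) (K : set X)
    (f : X -> V) : closed K -> continuous f -> (forall x, ~ K x -> f x = 0) ->
  C_K K f.
Proof.
move=> clK cf f0; split => //; rewrite /fsupport (closure_id K).1//.
apply: closureS => x /= /eqP fx0; apply: contrapT => nKx; exact/fx0/f0.
Qed.

Lemma C_KD (X : topologicalType) (V : topologicalZmodType) (K L : set X)
    (f g : X -> V) : C_K K f -> C_K L g -> C_K (K `|` L) (f + g).
Proof.
move=> [cf fK] [cg gL]; split; first exact: continuous_add.
apply: subset_trans (setUSS fK gL); rewrite /fsupport -closureU.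
apply: closureS => x /=; rewrite -[(f + g) x]/(f x + g x) => fg0.
have [fx0|fx0] := eqVneq (f x) 0; last by left.
by right; rewrite fx0 add0r in fg0.
Qed.

Lemma C_K0 (X : topologicalType) (V : topologicalZmodType) (K : set X) :
  C_K K (0 : X -> V).
Proof.
split; first by move=> x; exact: cst_continuous.
rewrite /fsupport (_ : [set x | _] = set0) ?closure0//.
by apply/seteqP; split => // x /=; rewrite eqxx.
Qed.

Lemma C_union0 (X : topologicalType) (V : topologicalZmodType) :
  C_union (0 : X -> V).
Proof. by exists set0; split; [exact: compact0|exact: C_K0]. Qed.

Lemma colim_open_setD (X : topologicalType) (V : topologicalZmodType)
    (C : set (X -> V)) :
    (forall K, compact K -> forall f, C_K K f -> ~ C f ->
      exists2 U, nbhs 0 U &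
        forall g, C_K K g -> (forall x, U (g x - f x)) -> ~ C g) ->
  colim_open (@C_union X V `\` C).
Proof.
move=> H; split; first by move=> f [].
move=> K cK; split; first by move=> f [].
move=> f [[_ nCf] Kf]; have [U U0 UC] := H K cK f Kf nCf.
exists U; split => // g [Kg Ug]; split => //; split; first by exists K.
exact: UC Ug.
Qed.

(** All that the refutations use of ACP: continuity of addition at (0, 0), with one neighbourhood
    serving for both summands. *)
Lemma ACP_add0 (X : topologicalType) (V : topologicalZmodType) (W : set (X -> V)) :
    ACP X V -> colim_open W -> W 0 ->
  exists2 A, colim_open A /\ A 0 & forall a b, A a -> A b -> W (a + b).
Proof.
move=> [add _] oW W0; have C0 := C_union0 X V.
have [|A [B [oA oB A0 B0 ABW]]] := add 0 0 C0 C0 W oW; first by rewrite addr0.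
exists (A `&` B); last by move=> a b [Aa _] [_ Bb]; exact: ABW.
split => //; split; first by move=> f [/oA.1].
move=> K cK; split; first by move=> f [].
move=> f [[Af Bf] Kf].
have [U [U0 UA]] := (oA.2 K cK).2 f (conj Af Kf).
have [U' [U'0 UB]] := (oB.2 K cK).2 f (conj Bf Kf).
exists (U `&` U'); split; first exact: filterI.
move=> g [Kg Ug]; split => //; split.
  by have [] : (A `&` C_K K) g by apply: UA; split => // x; have [] := Ug x.
by have [] : (B `&` C_K K) g by apply: UB; split => // x; have [] := Ug x.
Qed.

Lemma colim_open_near0 (X : topologicalType) (V : topologicalZmodType)
    (A : set (X -> V)) (K : set X) : colim_open A -> A 0 -> compact K ->
  exists2 U, nbhs 0 U & forall g, C_K K g -> (forall x, U (g x)) -> A g.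
Proof.
move=> [_ oA] A0 cK; have [U [U0 UA]] := (oA K cK).2 0 (conj A0 (C_K0 V K)).
exists U => // g Kg Ug; have [] // : (A `&` C_K K) g.
by apply: UA; split => // x; rewrite -[(0 : X -> V) x]/(0 : V) subr0.
Qed.

Lemma near0_separates (V : topologicalZmodType) (d : V) : hausdorff_space V ->
  d != 0 -> exists2 U, nbhs (0 : V) U & ~ U d.
Proof.
move=> hV d0; apply: contrapT => noU; move/eqP: d0; apply; apply: hV => A B Ad B0.
apply: contrapT => AB; apply: noU; exists B => // Bd; apply: AB; exists d.
by split => //; exact: nbhs_singleton.
Qed.

Lemma near0_forall_seq (V : topologicalZmodType) (T : eqType) (s : seq T)
    (P : T -> set V -> Prop) :
    (forall k U W, P k U -> W `<=` U -> P k W) ->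
    (forall k, k \in s -> exists2 U, nbhs 0 U & P k U) ->
  exists2 U, nbhs 0 U & forall k, k \in s -> P k U.
Proof.
move=> Pmono; elim: s => [_|a s IH H]; first by exists setT => //; exact: filterT.
have [|U U0 UP] := IH; first by move=> k ks; apply: H; rewrite inE ks orbT.
have [W W0 WP] := H a (mem_head _ _).
exists (U `&` W) => [|k]; first exact: filterI.
rewrite inE => /predU1P[->|ks]; first exact: Pmono WP (@subIsetr _ _ _).
exact: Pmono (UP k ks) (@subIsetl _ _ _).
Qed.

(* The functions Y k j + Z k j form a closed set C of the colimit missing 0,
   but every neighbourhood A of 0 satisfies (A + A) `&` C !=set0: Y k j lies
   in A for all j once k is large, and Z k j does for this k once j is large. *)
Lemma not_ACP_of_separated (X : topologicalType) (V : topologicalZmodType)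
    (K0 : set X) (N : nat -> set V) (p : nat -> X) (L : nat -> set X)
    (Y Z : nat -> nat -> X -> V) : hausdorff_space V -> compact K0 ->
    (forall k, compact (L k)) ->
    (forall U, nbhs 0 U -> exists k, N k `<=` U) ->
    (forall k j, C_K K0 (Y k j)) ->
    (forall k j x, N k (Y k j x)) ->
    (forall k, exists2 U, nbhs 0 U & forall i j, (i < j)%N ->
      exists2 x, K0 x & ~ U (Y k i x - Y k j x)) ->
    (forall k j, C_K (L k) (Z k j)) ->
    (forall k j x, K0 x -> Z k j x = 0) ->
    (forall k U, nbhs 0 U -> exists j, forall x, U (Z k j x)) ->
    (forall k j, Z k j (p k) != 0) ->
    (forall K, compact K -> exists n, forall k, (n <= k)%N -> ~ K (p k)) ->
  ~ ACP X V.
Proof.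
move=> hV cK0 cL Nbase YK YN Ysep ZL ZK0 Zsmall Zp pK acp.
pose C := [set h : X -> V | exists k j, h = Y k j + Z k j].
have nK0 k : ~ K0 (p k) by move=> /(ZK0 k 0)/eqP; apply/negP.
have YZp k j : (Y k j + Z k j) (p k) != 0.
  rewrite -[X in X != 0]/(Y k j (p k) + Z k j (p k)).
  by rewrite (C_K_eq0 (YK k j) (nK0 k)) add0r.
have oW : colim_open (@C_union X V `\` C).
  apply: colim_open_setD => K cK f Kf nCf.
  (* For k >= n every Y k j + Z k j is nonzero at [p k], a point outside [K]; only the finitely many
     k < n can bring a member of [C] into [C_K K]. *)
  have [n nK] := pK K cK.
  pose P k (U : set V) := forall j, ~ forall x, U ((Y k j + Z k j) x - f x).
  have PE k : k \in iota 0 n -> exists2 U, nbhs 0 U & P k U.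
    move=> _; have [U U0 Usep] := Ysep k; have [U' U'0 U'U] := near0_addsub U0.
    (* Separation on [K0] leaves at most one j with [Y k j] close to [f] there; as [Z k j] vanishes
       on [K0], only this j can give a member of [C] close to [f]. *)
    have uniq i j : (forall x, K0 x -> U' (Y k i x - f x)) ->
        (forall x, K0 x -> U' (Y k j x - f x)) -> i = j.
      wlog ij : i j / (i <= j)%N.
        move=> wl Hi Hj; have [ij|ji] := leqP i j; first exact: wl.
        by apply/esym/wl => //; exact: ltnW.
      move=> Hi Hj; apply/eqP; rewrite eqn_leq ij /= leqNgt; apply/negP => ltij.
      have [x K0x] := Usep _ _ ltij; apply.
      have [_] := U'U _ _ (Hi x K0x) (Hj x K0x).
      by rewrite opprB addrA subrK.
    have onK0 W j : W `<=` U' -> (forall x, W ((Y k j + Z k j) x - f x)) ->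
        forall x, K0 x -> U' (Y k j x - f x).
      move=> WU' H x K0x; apply: WU'; have := H x.
      by rewrite -[(Y k j + Z k j) x]/(Y k j x + Z k j x) (ZK0 k j x K0x) addr0.
    (* The possible index [j0] is excluded by shrinking [U']: [f] is not in [C], hence differs from
       Y k j0 + Z k j0 at some point. *)
    have [[j0 Hj0]|noj] := pselect (exists j, forall x, K0 x -> U' (Y k j x - f x)).
      have [x fx] : exists x, (Y k j0 + Z k j0) x - f x != 0.
        apply: contrapT => H; apply: nCf; exists k, j0; apply/funext => x.
        by apply: contrapT => /eqP fx; apply: H; exists x; rewrite subr_eq0 eq_sym.
      have [W W0 nW] := near0_separates hV fx.
      exists (U' `&` W) => [|j H]; first exact: filterI.
      have jj0 : j = j0 by apply: uniq => //; exact: onK0 H.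
      by apply: nW; rewrite -jj0; have [] := H x.
    exists U' => // j H; apply: noj; exists j; exact: onK0 H.
  have Pmono k U W : P k U -> W `<=` U -> P k W.
    by move=> H WU j Wj; apply: (H j) => x; exact/WU.
  have [U U0 UP] := near0_forall_seq Pmono PE.
  exists U => // g Kg Ug [k [j gE]]; have [kn|nk] := ltnP k n.
    by apply: (UP k _ j) => [|x]; rewrite ?mem_iota// -gE.
  by have := YZp k j; rewrite -gE (C_K_eq0 Kg (nK _ nk)) eqxx.
have W0 : (@C_union X V `\` C) 0.
  split; first exact: C_union0.
  by move=> [k [j E]]; have := YZp k j; rewrite -E eqxx.
have [A [oA A0] AA] := ACP_add0 acp oW W0.
have [U U0 UA] := colim_open_near0 oA A0 cK0; have [k NU] := Nbase U U0.
have [U' U'0 U'A] := colim_open_near0 oA A0 (cL k); have [j Zj] := Zsmall k U' U'0.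
have [_] : (@C_union X V `\` C) (Y k j + Z k j).
  by apply: AA; [apply: UA => // x; exact: NU|exact: U'A].
by apply; exists k, j.
Qed.

(** * Compact exhaustions and bump functions *)

(** Near-covering compactness, applied to the filter on [set X] generated by the up-sets of members
    of [D]; directedness makes it a filter. Members of [D] need not be open. *)
Lemma compact_sub_directed (X : topologicalType) (K : set X)
    (D : set (set X)) : compact K -> D !=set0 ->
    (forall A B, D A -> D B -> exists2 C, D C & A `|` B `<=` C) ->
    (forall x, K x -> exists2 A, D A & nbhs x A) ->
  exists2 A, D A & K `<=` A.
Proof.
move=> /compact_near_coveringP cK [A0 DA0] dirD KD.
pose F := filter_from D (fun A => [set B : set X | A `<=` B]).
have FF : Filter F.
  apply: filter_from_filter; first by exists A0.
  move=> A B DA DB; have [C DC ABC] := dirD A B DA DB.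
  by exists C => // E CE; split => x Hx; apply/CE/ABC; [left|right].
have [|A DA H] := cK _ F (fun B x => B x) FF; last first.
  by exists A => //; apply: (H A) => x.
move=> x /KD[A DA xA]; exists (A, [set B : set X | A `<=` B]) => /=.
  by split => //; exists A.
by move=> [y B] [/= Ay AB]; exact: AB.
Qed.

Lemma locally_compact_nbhs (X : topologicalType) (x : X) :
  locally_compact [set: X] -> exists2 C, compact C & nbhs x C.
Proof.
move=> /(_ x I); rewrite /precompact /compact_near => -[C xC [cC _]].
by exists C => //; move: xC; rewrite withinET.
Qed.

Lemma compact_nbhs_compact (X : topologicalType) (K : set X) :
  locally_compact [set: X] -> compact K -> exists2 C, compact C & K `<=` C^°.
Proof.
move=> lcX cK; have [||||_ [C cC <-] KC] :=
    @compact_sub_directed X K [set A | exists2 C, compact C & C^° = A]; last by exists C.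
- by [].
- by exists (set0^°); exists set0 => //; exact: compact0.
- move=> _ _ [C cC <-] [C' cC' <-]; exists ((C `|` C')^°).
    by exists (C `|` C') => //; exact: compactU.
  move=> x [|]; apply: interiorS; [exact: subsetUl|exact: subsetUr].
- move=> x Kx; have [C cC xC] := locally_compact_nbhs x lcX.
  by exists (C^°); [exists C|exact: nbhs_interior].
Qed.

(** The [Kn] are enlarged to compact neighbourhoods, since a compact subset of [A] need not lie in
    finitely many [Kn]; finite unions of the interiors form a chain of open sets covering [A]. The
    sets [L n] may leave [A]. *)
Lemma sigma_compact_exhaustion (X : topologicalType) (A : set X) :
    locally_compact [set: X] -> sigma_compact A ->
  exists2 L : nat -> set X, forall n, compact (L n) &
    forall K, compact K -> K `<=` A ->
      exists n, forall m, (n <= m)%N -> K `<=` L m.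
Proof.
move=> lcX [Kn [cKn ->]].
have [C CP] := choice (fun n => (exists2P _ _).1 (compact_nbhs_compact lcX (cKn n))).
exists (fun n => \bigcup_(i < n) C i) => [n|K cK KA].
  by rewrite bigcup_mkord; apply: bigsetU_compact => i _; have [] := CP i.
have mono n m : (n <= m)%N ->
    \bigcup_(i < n) (C i)^° `<=` \bigcup_(i < m) (C i)^°.
  by move=> nm x [i /= ni Cx]; exists i => //=; exact: leq_trans nm.
have [||||_ [n _ <-] KC] := @compact_sub_directed X K
    (range (fun n => \bigcup_(i < n) (C i)^°)); last first.
- exists n => m nm x /KC/(mono n m nm)[i /= im Cx]; exists i => //.
  exact: interior_subset.
- move=> x /KA[n _ Kx]; exists (\bigcup_(i < n.+1) (C i)^°); first by exists n.+1.
  have : nbhs x (C n)^° by apply: nbhs_interior; have [_] := CP n; exact.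
  by apply: filterS => y Cy; exists n => /=.
- move=> _ _ [n _ <-] [m _ <-]; exists (\bigcup_(i < maxn n m) (C i)^°).
    by exists (maxn n m).
  by rewrite subUset; split; apply: mono; [exact: leq_maxl|exact: leq_maxr].
- by exists (\bigcup_(i < 0) (C i)^°); exists 0.
- by [].
Qed.

Lemma bump_function (R : realType) (X : topologicalType) (x : X) (O : set X) :
    hausdorff_space X -> locally_compact [set: X] -> open O -> O x ->
  exists phi : X -> R, [/\ continuous phi, phi x = 1,
    forall y, ~ O y -> phi y = 0 & forall y, 0 <= phi y <= 1].
Proof.
move=> hX lcX oO Ox.
have clO : closed (~` O) by rewrite closedC.
have nOx : ~ (~` O) x by apply.
have /(@uniform_separatorP _ R)[f [cf f01 f0 f1]] :=
  @locally_compact_completely_regular X R lcX hX x (~` O) clO nOx.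
exists (fun y => 1 - f y); split.
- by move=> y; apply: cvgB; [exact: cvg_cst|exact: cf].
- by rewrite (f0 (f x)) ?subr0//; exists x.
- by move=> y nOy; rewrite (f1 (f y)) ?subrr//; exists y.
- move=> y; have /= := f01 (f y) (ex_intro2 _ _ y I erefl).
  by rewrite in_itv /= => /andP[fy0 fy1]; rewrite subr_ge0 fy1 lerBlDr lerDl.
Qed.

(** The k-th bump lives in the interior of [A] minus [L k]. This set is nonempty: otherwise [A], the
    closure of its interior, would be a closed subset of the compact [L k]. A compact K meets [A] in
    a compact set, which lies in [L k] for large k, so the bump vanishes on K. *)
Lemma escaping_bumps (R : realType) (X : topologicalType) (A : set X) :
    hausdorff_space X -> locally_compact [set: X] ->
    regular_closed A -> sigma_compact A -> ~ compact A ->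
  exists (p : nat -> X) (phi : nat -> X -> R) (M : nat -> set X),
    [/\ forall k, compact (M k) /\ forall x, ~ M k x -> phi k x = 0,
        forall k, continuous (phi k), forall k, phi k (p k) = 1,
        forall k x, 0 <= phi k x <= 1 &
        forall K, compact K ->
          exists n, forall k, (n <= k)%N -> forall x, K x -> phi k x = 0].
Proof.
move=> hX lcX rcA scA ncA.
have clA : closed A by rewrite rcA; exact: closed_closure.
have [L cL LK] := sigma_compact_exhaustion lcX scA.
have clL n : closed (L n) by apply: compact_closed.
have ne n : exists x, (A^° `\` L n) x.
  apply: contrapT => H; apply/ncA/(subclosed_compact clA (cL n)).
  rewrite {1}rcA (closure_id (L n)).1//; apply: closureS => x Ax.
  by apply: contrapT => nLx; apply: H; exists x.
have [p pP] := choice ne.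
have [M MP] := choice (fun k => (exists2P _ _).1 (locally_compact_nbhs (p k) lcX)).
have ph k : exists f : X -> R, [/\ continuous f, f (p k) = 1,
    forall y, ~ ((A^° `\` L k) `&` (M k)^°) y -> f y = 0 & forall y, 0 <= f y <= 1].
  apply: bump_function => //.
    apply: openI; last exact: open_interior.
    by apply: openI; [exact: open_interior|rewrite openC].
  by split; [exact: pP|have [] := MP k].
have [phi phiP] := choice ph.
exists p, phi, M; split.
- move=> k; split; first by have [] := MP k.
  move=> x nMx; have [_ _ f0 _] := phiP k; apply: f0 => -[_].
  by move=> /interior_subset.
- by move=> k; have [] := phiP k.
- by move=> k; have [] := phiP k.
- by move=> k; have [] := phiP k.
- move=> K cK; have cKA : compact (K `&` A) by apply: compact_closedI.
  have [n nL] := LK _ cKA (@subIsetr _ K A).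
  exists n => k nk x Kx; have [_ _ f0 _] := phiP k; apply: f0 => -[[Ax nLx] _].
  by apply/nLx/(nL k nk); split => //; exact: interior_subset.
Qed.

Lemma metrizable_hausdorff (R : realType) (T : topologicalType) :
  metrizable R T -> hausdorff_space T.
Proof.
move=> [d [d0 [dC [dT dO]]]] p q pq; apply/d0/eqP.
have dpp x : d x x = 0 by apply/d0.
have dge0 x y : 0 <= d x y.
  by have := dT x y x; rewrite dpp (dC y x) -mulr2n pmulrn_lge0.
have ballN x e : 0 < e -> nbhs x [set y | d x y < e].
  move=> e0; apply: open_nbhs_nbhs; split; last by rewrite /= dpp.
  apply/dO => y /= xy; exists (e - d x y); rewrite subr_gt0; split => // z /=.
  by rewrite ltrBrDl; apply: le_lt_trans; exact: dT.
rewrite eq_le dge0 andbT leNgt; apply/negP => dpq.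
have dpq2 : 0 < d p q / 2 by rewrite divr_gt0.
have [z [/= pz qz]] := pq _ _ (ballN p _ dpq2) (ballN q _ dpq2).
have := dT p z q; rewrite (dC z q) leNgt => /negP; apply.
by rewrite [ltRHS](splitr (d p q)) ltrD.
Qed.

Lemma metrizable_countable_base (R : realType) (T : topologicalType) (x : T) :
    metrizable R T ->
  exists2 N : nat -> set T, forall k, nbhs x (N k) &
    forall U, nbhs x U -> exists k, N k `<=` U.
Proof.
move=> [d [d0 [dC [dT dO]]]]; exists (fun k => [set y | d x y < k.+1%:R^-1]).
  move=> k; apply: open_nbhs_nbhs; split; last by rewrite /= (d0 x x).2.
  apply/dO => y /= xy; exists (k.+1%:R^-1 - d x y); rewrite subr_gt0; split => // z /=.
  by rewrite ltrBrDl; apply: le_lt_trans; exact: dT.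
move=> U; rewrite nbhsE => -[B [oB Bx] BU].
have [e [e0 eB]] := (dO B).1 oB x Bx.
have [k _ /(_ k (leqnn k)) /= ke] := near_infty_natSinv_lt (PosNum e0).
by exists k => y /= xy; apply/BU/eB => /=; exact: lt_trans ke.
Qed.

Lemma continuous_iota_scale (R : realType) (K : numFieldType)
    (iota : {rmorphism R -> K}) (X : topologicalType)
    (V : topologicalLmodType K) (phi : X -> R) (v : V) :
  scalar_embedding iota -> continuous phi -> continuous (fun x => iota (phi x) *: v).
Proof.
move=> [iotac _ _ _] cphi.
apply: (continuous_scale (c := fun x => iota (phi x) : K^o)); last first.
  by move=> x; exact: cst_continuous.
by move=> x; apply: continuous_comp; [exact: cphi|exact: iotac].
Qed.

Lemma near0_iota_scale (R : realType) (K : numFieldType)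
    (iota : {rmorphism R -> K}) (V : topologicalLmodType K) (v : V) (U : set V) :
    scalar_embedding iota -> nbhs 0 U ->
  exists2 e : R, 0 < e & forall t, `|t| < e -> U (iota t *: v).
Proof.
move=> [iotac _ _ _] U0; have [d d0 dU] := near0_absorbs_point v U0.
have : nbhs (iota 0 : K^o) [set c : K^o | `|c| < d].
  rewrite rmorph0; apply/nbhs_ballP; exists d => // c.
  by rewrite -ball_normE /= sub0r normrN.
move=> /iotac /nbhs_ballP[e /= e0 eB]; exists e => // t te.
by apply/dU/eB; rewrite -ball_normE /= sub0r normrN.
Qed.

(** * Finite dimension and discreteness from ACP *)

Lemma not_ACP_of_separated_nbhs (R : realType) (K : numFieldType)
    (iota : {rmorphism R -> K}) (X : topologicalType)
    (V : topologicalLmodType K) (A K0 : set X) :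
    scalar_embedding iota -> hausdorff_space X -> locally_compact [set: X] ->
    metrizable R V -> (exists v : V, v != 0) ->
    regular_closed A -> sigma_compact A -> ~ compact A -> compact K0 ->
    (forall N : set V, nbhs 0 N -> exists (Y : nat -> X -> V) (U : set V),
      [/\ nbhs 0 U, forall j, C_K K0 (Y j), forall j x, N (Y j x) &
        forall i j, (i < j)%N -> exists2 x, K0 x & ~ U (Y i x - Y j x)]) ->
  ~ ACP X V.
Proof.
move=> iotaP hX lcX mV [v v0] rcA scA ncA cK0 sepN.
have hV := metrizable_hausdorff mV.
have [N N0 Nbase] := metrizable_countable_base 0 mV.
have [p [phi [M [MP cphi phi1 phi01 phiK]]]] := escaping_bumps R hX lcX rcA scA ncA.
have [n0 n0P] := phiK K0 cK0.
have [Y YP] := choice (fun k => sepN _ (N0 k)).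
(* The shift by [n0] makes all these bumps vanish on [K0]; [j.+1] keeps the divisor nonzero. *)
pose Z k j x : V := iota (phi (k + n0)%N x / j.+1%:R) *: v.
have iota_eq0 t : (iota t *: v == 0) = (t == 0).
  by rewrite scaler_eq0 (negbTE v0) orbF fmorph_eq0.
apply: (@not_ACP_of_separated X V K0 N (fun k => p (k + n0)%N)
  (fun k => M (k + n0)%N) Y Z hV cK0) => //.
- by move=> k; have [] := MP (k + n0)%N.
- by move=> k j; have [U [_ YK _ _]] := YP k; exact: YK.
- by move=> k j x; have [U [_ _ YN _]] := YP k; exact: YN.
- by move=> k; have [U [U0 _ _ YU]] := YP k; exists U.
- move=> k j; have [cM M0] := MP (k + n0)%N; apply: C_K_closed.
  + exact: compact_closed.
  + apply: continuous_iota_scale => //.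
    by move=> x; apply: cvgMl; exact: cphi.
  + by move=> x /M0 phi0; rewrite /Z phi0 mul0r rmorph0 scale0r.
- by move=> k j x K0x; rewrite /Z n0P ?leq_addl// mul0r rmorph0 scale0r.
- move=> k U U0; have [e e0 eU] := near0_iota_scale v iotaP U0.
  have [j _ /(_ j (leqnn j)) /= je] := near_infty_natSinv_lt (PosNum e0).
  exists j => x; apply: eU; have /andP[ph0 ph1] := phi01 (k + n0)%N x.
  rewrite ger0_norm ?divr_ge0//; apply: le_lt_trans je.
  by rewrite -[leRHS]mul1r ler_wpM2r// invr_ge0.
- by move=> k j; rewrite /Z iota_eq0 phi1 mul1r invr_eq0 pnatr_eq0.
- move=> C cC; have [n nP] := phiK C cC; exists n => k nk Cp.
  have := nP (k + n0)%N (leq_trans nk (leq_addr _ _)) _ Cp.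
  by rewrite phi1 => /eqP; rewrite oner_eq0.
Qed.

(** A Riesz sequence in a balanced neighbourhood is spread over one bump: values stay in the
    neighbourhood because the bump lies in [0, 1], and separation is read off at the peak [p 0]. *)
Lemma ACP_finite_dimensional (R : realType) (K : numFieldType)
    (iota : {rmorphism R -> K}) (X : topologicalType)
    (V : topologicalLmodType K) (A : set X) :
    scalar_embedding iota -> hausdorff_space X -> locally_compact [set: X] ->
    metrizable R V -> (exists v : V, v != 0) ->
    regular_closed A -> sigma_compact A -> ~ compact A ->
  ACP X V -> finite_dimensional V.
Proof.
move=> iotaP hX lcX mV Vnt rcA scA ncA acp; apply: contrapT => infV.
have hV := metrizable_hausdorff mV.
have [p [phi [M [MP cphi phi1 phi01 _]]]] := escaping_bumps R hX lcX rcA scA ncA.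
have [cM M0] := MP 0.
apply: (not_ACP_of_separated_nbhs iotaP hX lcX mV Vnt rcA scA ncA cM) acp.
move=> N /near0_balanced[W [W0 WN bal]].
have [y [U [U0 Wy yU]]] := infinite_dimensional_separated iotaP hV infV W0.
exists (fun j x => iota (phi 0 x) *: y j), U; split => //.
- move=> j; apply: C_K_closed; first exact: compact_closed.
    exact: continuous_iota_scale.
  by move=> x /M0 ->; rewrite rmorph0 scale0r.
- move=> j x; apply/WN/bal => //; have [_ iotaN iota_le _] := iotaP.
  have /andP[ph0 ph1] := phi01 0 x.
  by rewrite iotaN -(rmorph1 iota) iota_le ger0_norm.
- move=> i j ij; exists (p 0); last by rewrite !phi1 rmorph1 !scale1r; exact: yU.
  by apply: contrapT => /M0/eqP; rewrite phi1 oner_eq0.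
Qed.

(** Nested open neighbourhoods [S j] of [x0]: [psi j] lives in [S j], peaks at a point other than
    [x0] and vanishes on [S j.+1], which contains all later peaks. Non-isolation supplies the peak,
    the Hausdorff property the smaller neighbourhood. *)
Lemma shrinking_bumps (R : realType) (X : topologicalType) (x0 : X) (O0 : set X) :
    hausdorff_space X -> locally_compact [set: X] -> ~ open [set x0] ->
    open O0 -> O0 x0 ->
  exists (p : nat -> X) (psi : nat -> X -> R),
    [/\ forall j, continuous (psi j), forall j, psi j (p j) = 1,
        forall j x, 0 <= psi j x <= 1, forall j x, ~ O0 x -> psi j x = 0 &
        forall i j, (i < j)%N -> psi i (p j) = 0].
Proof.
move=> hX lcX nx0 oO0 O0x0.
pose good (O : set X) := open O /\ O x0.
(* A triple holds the next neighbourhood, the peak and the bump. The requirement is an implication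
   from [good O] so that [choice] applies to all sets, with a dummy triple where it fails. *)
pose next (O : set X) (t : set X * X * (X -> R)) := good O ->
  [/\ good t.1.1, t.1.1 `<=` O, O t.1.2 &
  [/\ continuous t.2, t.2 t.1.2 = 1, forall x, 0 <= t.2 x <= 1,
      forall x, ~ O x -> t.2 x = 0 & forall x, t.1.1 x -> t.2 x = 0]].
have step O : exists t, next O t.
  have [[oO Ox0]|ngood] := pselect (good O); last first.
    by exists (set0, x0, fun=> 0) => /ngood.
  have [p Op px0] : exists2 p, O p & p != x0.
    apply: contrapT => noP; apply: nx0; rewrite (_ : [set x0] = O)//.
    apply/seteqP; split => [_ ->//|y Oy]; apply: contrapT => /eqP yx0.
    by apply: noP; exists y.
  have := hX; rewrite open_hausdorff => /(_ _ _ px0).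
  move=> [[G H] /= [/set_mem Gp /set_mem Hx0] [oG oH /eqP GH]].
  have [f [cf fp f0 f01]] := @bump_function R X p (O `&` G) hX lcX
    (openI oO oG) (conj Op Gp).
  exists (O `&` H, p, f) => _; split => //=.
  - by split; [exact: openI|].
  - split => //.
      by move=> y nOy; apply: f0 => -[].
    move=> y [_ Hy]; apply: f0 => -[_ Gy].
    by have : (G `&` H) y by []; rewrite GH.
have [t tP] := choice step.
pose S j := iter j (fun O => (t O).1.1) O0.
have Sgood j : good (S j) by elim: j => // j IH; have [] := tP (S j) IH.
have Sdecr i j : (i <= j)%N -> S j `<=` S i.
  elim: j => [|j IH]; first by rewrite leqn0 => /eqP ->.
  rewrite leq_eqVlt => /predU1P[->//|/IH]; apply: subset_trans.
  by have [] := tP (S j) (Sgood j).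
exists (fun j => (t (S j)).1.2), (fun j => (t (S j)).2); split.
- by move=> j; have [_ _ _ []] := tP (S j) (Sgood j).
- by move=> j; have [_ _ _ []] := tP (S j) (Sgood j).
- by move=> j; have [_ _ _ []] := tP (S j) (Sgood j).
- move=> j x nOx; have [_ _ _ [_ _ _ + _]] := tP (S j) (Sgood j); apply.
  by move=> /(Sdecr 0 j (leq0n j)).
- move=> i j ij; have [_ _ _ [_ _ _ _]] := tP (S i) (Sgood i); apply.
  by apply: (Sdecr i.+1 j ij); have [] := tP (S j) (Sgood j).
Qed.

(** On a compact neighbourhood of a non-isolated point, the functions (e/2) psi_j v take values in
    the prescribed neighbourhood, yet for i < j the i-th minus the j-th has the fixed value - (e/2)
    v at p_j. *)
Lemma ACP_discrete (R : realType) (K : numFieldType)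
    (iota : {rmorphism R -> K}) (X : topologicalType)
    (V : topologicalLmodType K) (A : set X) :
    scalar_embedding iota -> hausdorff_space X -> locally_compact [set: X] ->
    metrizable R V -> (exists v : V, v != 0) ->
    regular_closed A -> sigma_compact A -> ~ compact A ->
  ACP X V -> forall x : X, open [set x].
Proof.
move=> iotaP hX lcX mV Vnt rcA scA ncA acp x0; apply: contrapT => nx0.
have [v v0] := Vnt; have hV := metrizable_hausdorff mV.
have [C cC Cx0] := locally_compact_nbhs x0 lcX.
have [p [psi [cpsi psi1 psi01 psiC psi0]]] :=
  shrinking_bumps R hX lcX nx0 (open_interior C) Cx0.
apply: (not_ACP_of_separated_nbhs iotaP hX lcX mV Vnt rcA scA ncA cC) acp.
move=> N N0; have [e e0 eN] := near0_iota_scale v iotaP N0.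
have nz : - (iota (e / 2) *: v) != 0.
  by rewrite oppr_eq0 scaler_eq0 (negbTE v0) orbF fmorph_eq0 gt_eqF// divr_gt0.
have [U U0 nU] := near0_separates hV nz.
exists (fun j x => iota (e / 2 * psi j x) *: v), U; split => //.
- move=> j; apply: C_K_closed; first exact: compact_closed.
    apply: continuous_iota_scale => // x.
    by apply: cvgMr; exact: cpsi.
  move=> x nCx; rewrite psiC ?mulr0 ?rmorph0 ?scale0r//.
  by move=> /interior_subset.
- move=> j x; apply: eN; have /andP[ps0 ps1] := psi01 j x.
  rewrite ger0_norm ?mulr_ge0 ?divr_ge0 ?(ltW e0)//.
  rewrite (@le_lt_trans _ _ (e / 2))//; last by rewrite ltr_pdivrMr// ltr_pMr// ltr1n.
  by rewrite ler_piMr// divr_ge0// ltW.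
- move=> i j ij; exists (p j); last by rewrite psi0// psi1 mulr0 mulr1 rmorph0 scale0r sub0r.
  apply: contrapT => nCp; have : psi j (p j) = 0.
    by apply: psiC => /interior_subset.
  by rewrite psi1 => /eqP; rewrite oner_eq0.
Qed.

(* Well-order T; on the points with countably many predecessors, c a b is a
   code of b in an enumeration of the predecessors of a. *)
Lemma uncountable_pair_coloring (T : choiceType) : ~ countable [set: T] ->
  exists c : T -> T -> nat, forall n : T -> nat,
    exists a b, [/\ a != b, (n a <= c a b)%N & (n b <= c a b)%N].
Proof.
move=> ncT; have [r wo] := wochoice.well_ordering_principle T.
have rmin (A : set T) : A !=set0 -> exists2 m, A m & forall x, A x -> r m x.
  move=> [x Ax]; have [|m [[/asboolP Am mP] _]] := wo (fun x => `[< A x >]).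
    by exists x; exact/asboolP.
  by exists m => // y Ay; apply: mP; exact/asboolP.
have rtot a b : r a b \/ r b a.
  have [m [->|->] mP] := rmin [set a; b] (ex_intro _ a (or_introl erefl)).
    by left; apply: mP; right.
  by right; apply: mP; left.
have rxx a : r a a by have [] := rtot a a.
have ranti a b : r a b -> r b a -> a = b.
  move=> rab rba; have [|m [_ mU]] := wo (pred2 a b); first by exists a; exact: predU1l.
  transitivity m; [apply/esym|]; apply: mU; split; rewrite ?inE ?eqxx ?orbT//.
    by move=> x; rewrite !inE => /orP[/eqP->|/eqP->].
  by move=> x; rewrite !inE => /orP[/eqP->|/eqP->].
pose below a := [set b | b != a /\ r b a].
pose T0 := [set a | countable (below a)].
(* Were [T0] countable, a least element outside it would have all its predecessors in [T0], hence
   countably many, and so belong to [T0]; thus [T0] would be everything. *)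
have ncT0 : ~ countable T0.
  move=> cT0; have [H|H] := pselect (~` T0 !=set0).
    have [m nTm mP] := rmin _ H; apply: nTm; apply: sub_countable cT0.
    apply: subset_card_le => b [bm rbm]; apply: contrapT => nTb.
    by move/eqP: bm; apply; apply: ranti => //; exact: mP.
  apply/ncT/(sub_countable _ cT0)/subset_card_le => a _.
  by apply: contrapT => nTa; apply: H; exists a.
have [e eP] : {e : T -> T -> nat & forall a, T0 a -> {in below a &, injective (e a)}}.
  apply: (@choice _ _ (fun a (f : T -> nat) => T0 a -> {in below a &, injective f})) => a.
  have [/countable_injP[f fP]|nTa] := pselect (T0 a); first by exists f.
  by exists (fun=> 0%N).
exists e => n.
(* The values of [n] partition the uncountable [T0] into countably many cells, so [n] is constant on
   an uncountable one. *)
have [m ncS] : exists m, ~ countable (T0 `&` [set a | n a = m]).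
  apply: contrapT => H; apply: ncT0.
  rewrite (_ : T0 = \bigcup_m (T0 `&` [set a | n a = m])); last first.
    by apply/seteqP; split => [a Ta|a [m _ []//]]; exists (n a).
  apply: bigcup_countable => // m _; apply: contrapT => ncm; apply: H.
  by exists m.
set S := T0 `&` _ in ncS.
have : infinite_set S by move=> /finite_set_countable.
move=> /infiniteP/card_leP[g]; pose d i := set_val (g (to_setT i)).
have dS i : S (d i) by exact: set_valP.
have dinj : injective d.
  by move=> i j /val_inj/inj Eij; have /(congr1 val) := Eij (in_setT _) (in_setT _).
(* The countably many [d i] and their predecessors cannot exhaust [S], so some [a] in [S] lies above
   every [d i]. *)
have cD : countable (\bigcup_i (d i |` below (d i))).
  apply: bigcup_countable => // i _; have [cdi _] := dS i.
  rewrite (_ : _ |` _ = \bigcup_(b in [set true; false]) (if b then [set d i] else below (d i))).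
    apply: bigcup_countable; first exact: finite_set_countable.
    by move=> [] _ //; exact: countable1.
  apply/seteqP; split => [x [->|bx]|x [[] _]]; [by exists true; [left|]|by exists false; [right|]|by left|by right].
have [a Sa aD] : exists2 a, S a & ~ (\bigcup_i (d i |` below (d i))) a.
  apply: contrapT => H; apply/ncS/(sub_countable _ cD)/subset_card_le => a Sa.
  by apply: contrapT => aD; apply: H; exists a.
have ad i : a != d i by apply/eqP => E; apply: aD; exists i => //; left.
have dbelow i : below a (d i).
  split; first by rewrite eq_sym.
  have [//|rad] := rtot (d i) a; exfalso; apply: aD; exists i => //; right.
  by split.
(* The codes of the [d i] below [a] are distinct, so m + 1 of them cannot all be smaller than m. *)
have [i mi] : exists i, (m <= e a (d i))%N.
  apply: contrapT => H; have lt i : (e a (d i) < m)%N.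
    by rewrite ltnNge; apply/negP => mi; apply: H; exists i.
  have : injective (fun i : 'I_m.+1 => Ordinal (lt i)).
    move=> i j [Eij]; have [Ta _] := Sa.
    by apply/val_inj/dinj/(eP a Ta _ _ _ _ Eij); exact/mem_set.
  by move=> /leq_card; rewrite !card_ord ltnn.
exists a, (d i); split => //.
  by have [_ /= ->] := Sa.
by have [_ /= ->] := dS i.
Qed.

(** * ACP on discrete spaces *)

Lemma discrete_open_set (X : topologicalType) (A : set X) :
  (forall x : X, open [set x]) -> open A.
Proof.
move=> dX; rewrite openE => x Ax; apply: (@filterS _ _ _ [set x]) => [y ->//|].
by apply: open_nbhs_nbhs; split.
Qed.

Lemma discrete_continuous (X Y : topologicalType) (f : X -> Y) :
  (forall x : X, open [set x]) -> continuous f.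
Proof.
move=> dX x A fxA; apply: open_nbhs_nbhs; split; first exact: discrete_open_set.
by have := nbhs_singleton fxA.
Qed.

Lemma discrete_compact_finite (X : topologicalType) (K : set X) :
  (forall x : X, open [set x]) -> compact K -> finite_set K.
Proof.
move=> dX cK; have [||x _|A finA KA] := @compact_sub_directed X K finite_set cK.
- by exists set0.
- by move=> A B finA finB; exists (A `|` B) => //; rewrite finite_setU.
- by exists [set x] => //; apply: open_nbhs_nbhs; split.
- exact: sub_finite_set KA finA.
Qed.

(* With c a coloring as in uncountable_pair_coloring and w n --> 0, the
   functions taking the value w (c a b) at a and b and 0 elsewhere form a
   closed set that meets A + A for every neighbourhood A of 0. *)
Lemma ACP_discrete_countable (R : realType) (K : numFieldType)
    (iota : {rmorphism R -> K}) (X : topologicalType)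
    (V : topologicalLmodType K) :
    scalar_embedding iota -> hausdorff_space V -> (exists v : V, v != 0) ->
    (forall x : X, open [set x]) ->
  ACP X V -> countable [set: X].
Proof.
move=> iotaP hV [v v0] dX acp; apply: contrapT => /uncountable_pair_coloring[c cP].
pose w n : V := iota n.+1%:R^-1 *: v.
have w0 n : w n != 0.
  by rewrite scaler_eq0 (negbTE v0) orbF fmorph_eq0 invr_eq0 pnatr_eq0.
pose h a b x : V := if (x == a) || (x == b) then w (c a b) else 0.
pose delta (a : X) n (x : X) : V := if x == a then w n else 0.
pose C := [set g : X -> V | exists a b, a != b /\ g = h a b].
have oW : colim_open (@C_union X V `\` C).
  apply: colim_open_setD => L cL f Lf nCf.
  (* A function [h a b] supported in [L] has both a and b in this finite set, so only finitely many
     pairs have to be excluded. *)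
  have /finite_seqP[s Ls] := discrete_compact_finite dX cL.
  pose P (q : X * X) (U : set V) := q.1 != q.2 ->
    ~ forall x, U (h q.1 q.2 x - f x).
  have PE q : q \in [seq (a, b) | a <- s, b <- s] -> exists2 U, nbhs 0 U & P q U.
    move=> _; have [qq|qq] := eqVneq q.1 q.2.
      by exists setT; [exact: filterT|rewrite /P qq eqxx].
    have [x hx] : exists x, h q.1 q.2 x - f x != 0.
      apply: contrapT => H; apply: nCf; exists q.1, q.2; split => //.
      apply/funext => x; apply: contrapT => /eqP fx; apply: H; exists x.
      by rewrite subr_eq0 eq_sym.
    by have [U U0 nU] := near0_separates hV hx; exists U => // _; exact.
  have Pmono q U W : P q U -> W `<=` U -> P q W.
    by move=> H WU /H nU Wq; apply: nU => x; exact/WU.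
  have [U U0 UP] := near0_forall_seq Pmono PE.
  exists U => // g Lg Ug [a [b [ab gE]]].
  have mem x : (x == a) || (x == b) -> x \in s.
    move=> xab; suff : L x by rewrite Ls.
    apply: contrapT => /(C_K_eq0 Lg)/eqP; rewrite gE /h xab.
    exact/negP.
  apply: (UP (a, b) _ ab) => [|x]; last by rewrite -gE.
  by apply/allpairsP; exists (a, b); rewrite /= !mem ?eqxx ?orbT.
have W0 : (@C_union X V `\` C) 0.
  split; first exact: C_union0.
  move=> [a [b [ab E]]]; have := w0 (c a b); have /= := congr1 (fun g => g a) E.
  by rewrite /h eqxx /= => <-; rewrite eqxx.
have [A [oA A0] AA] := ACP_add0 acp oW W0.
(* The threshold n, as a function of a, is fed to the coloring: at the resulting pair [c a b]
   reaches both thresholds, so both point masses lie in [A]. *)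
have nA a : exists n, forall m, (n <= m)%N -> A (delta a m).
  have [U U0 UA] := colim_open_near0 oA A0 (@compact_set1 _ a).
  have [e e0 eU] := near0_iota_scale v iotaP U0.
  have [n _ ne] := near_infty_natSinv_lt (PosNum e0).
  exists n => m nm; apply: UA.
    apply: C_K_closed; last by move=> x /= /eqP xa; rewrite /delta (negbTE xa).
      by rewrite -openC; exact: discrete_open_set.
    exact: discrete_continuous.
  move=> x; rewrite /delta; case: eqP => _; last exact: nbhs_singleton.
  apply: eU; rewrite ger0_norm ?invr_ge0//; exact: (ne m nm).
have [n nP] := choice nA.
have [a [b [ab na nb]]] := cP n.
have hE : h a b = delta a (c a b) + delta b (c a b).
  apply/funext => x; rewrite -[RHS]/(delta a _ x + delta b _ x) /h /delta.
  have [->|xa] := eqVneq x a; first by rewrite (negbTE ab) addr0.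
  by rewrite /= add0r.
have [_] : (@C_union X V `\` C) (h a b) by rewrite hE; apply: AA; exact: nP.
by apply; exists a, b.
Qed.

Lemma discrete_homeomorphic_nat (X : topologicalType) :
    (forall x : X, open [set x]) -> countable [set: X] -> infinite_set [set: X] ->
  homeomorphic_to_discrete_nat X.
Proof.
move=> dX cX iX; have /card_set_bijP[f /= fbij] := eq_card_nat cX iX.
have [g fK gK] : bijective f by rewrite -setTT_bijective.
exists f, g; split => //; split => //; split; first exact: discrete_continuous.
by apply: discrete_continuous => n; exact: discrete_open.
Qed.

(** * Boxes *)

Lemma C_KN (X : topologicalType) (V : topologicalZmodType) (K : set X)
    (f : X -> V) : C_K K f -> C_K K (- f).
Proof.
move=> [cf fK]; split.
  move=> x; apply: (@continuous_comp _ _ _ f (-%R : V -> V)); first exact: cf.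
  exact: opp_continuous.
rewrite /fsupport (_ : [set x | _] = [set x | f x != 0])//.
by apply/seteqP; split => x /=; rewrite -[(- f) x]/(- f x) oppr_eq0.
Qed.

Lemma C_unionD (X : topologicalType) (V : topologicalZmodType) (f g : X -> V) :
  C_union f -> C_union g -> C_union (f + g).
Proof.
move=> [K [cK Kf]] [L [cL Lg]]; exists (K `|` L).
by split; [exact: compactU|exact: C_KD].
Qed.

Lemma C_unionN (X : topologicalType) (V : topologicalZmodType) (f : X -> V) :
  C_union f -> C_union (- f).
Proof. by move=> [K [cK Kf]]; exists K; split => //; exact: C_KN. Qed.

Lemma colim_open_translate (X : topologicalType) (V : topologicalZmodType)
    (s : X -> V) (W : set (X -> V)) : C_union s -> colim_open W ->
  colim_open [set h | C_union h /\ W (h + s)].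
Proof.
move=> [L [cL Ls]] [_ oW]; split; first by move=> h [].
move=> K cK; split; first by move=> h [].
move=> h [[_ Whs] Kh]; have cKL : compact (K `|` L) by exact: compactU.
have [U [U0 UW]] := (oW _ cKL).2 _ (conj Whs (C_KD Kh Ls)).
exists U; split => // g [Kg Ug]; split => //; split; first by exists K.
have [] // : (W `&` C_K (K `|` L)) (g + s).
apply: UW; split; first exact: C_KD.
by move=> x; rewrite -[X in U X]/((g x + s x) - (h x + s x)) opprD addrACA subrr addr0.
Qed.

Lemma colim_open_opp (X : topologicalType) (V : topologicalZmodType)
    (W : set (X -> V)) :
  colim_open W -> colim_open [set f | C_union f /\ W (- f)].
Proof.
move=> [_ oW]; split; first by move=> h [].
move=> K cK; split; first by move=> h [].
move=> h [[_ Wh] Kh]; have [U [U0 UW]] := (oW _ cK).2 _ (conj Wh (C_KN Kh)).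
have [U' U'0 U'U] := near0_addsub U0.
exists U'; split => // g [Kg Ug]; split => //; split; first by exists K.
have [] // : (W `&` C_K K) (- g).
apply: UW; split => [|x]; first exact: C_KN.
rewrite -[X in U X]/(- g x - - h x) -opprD -[X in U X]add0r.
by have [] := U'U 0 (g x - h x) (nbhs_singleton U'0) (Ug x).
Qed.

(** Within [C_K K] only the finitely many points of [K] matter: off [K] both functions vanish, and
    the condition at x is inherited from [a]. *)
Lemma colim_open_box (X : topologicalType) (V : topologicalZmodType)
    (O : X -> set V) (f : X -> V) :
    (forall x : X, open [set x]) -> (forall x, open (O x)) ->
  colim_open [set a | C_union a /\ forall x, O x (a x - f x)].
Proof.
move=> dX oO; split; first by move=> a [].
move=> K cK; split; first by move=> a [].
move=> a [[_ Oa] Ka]; have /finite_seqP[s Ks] := discrete_compact_finite dX cK.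
pose P x (U : set V) := forall v, U v -> O x ((a x - f x) + v).
have PE x : x \in s -> exists2 U, nbhs 0 U & P x U.
  move=> _; have : nbhs (a x - f x) (O x) by apply: open_nbhs_nbhs; split.
  by move=> /nbhs_translate Ox; exists [set v | O x ((a x - f x) + v)].
have Pmono x U W : P x U -> W `<=` U -> P x W by move=> PU WU v /WU/PU.
have [U U0 UP] := near0_forall_seq Pmono PE.
exists U; split => // g [Kg Ug]; split => //; split; first by exists K.
move=> x; have [xs|xs] := boolP (x \in s).
  by have := UP x xs _ (Ug x); rewrite addrC addrA subrK.
have nKx : ~ K x by rewrite Ks /= => xs'; rewrite xs' in xs.
by have := Oa x; rewrite (C_K_eq0 Ka nKx) (C_K_eq0 Kg nKx).
Qed.

(* The box defined by F is compact by Tychonoff, so the tube lemma applies. *)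
Lemma extend_compact_box (K : numFieldType) (X : topologicalType)
    (V : topologicalLmodType K) (f : X -> nat) (g : nat -> X) (D : set V)
    (W : set (X -> V)) (n : nat) (F : nat -> set V) :
    cancel f g -> cancel g f -> (forall x : X, open [set x]) ->
    nbhs 0 D -> compact D -> colim_open W ->
    (forall i, compact (F i)) -> (forall i, (n <= i)%N -> F i = [set 0]) ->
    (forall h : X -> V, (forall x, F (f x) (h x)) -> W h) ->
  exists E, [/\ nbhs 0 E, compact E & forall h : X -> V,
    (forall x, (if f x == n then E else F (f x)) (h x)) -> W h].
Proof.
move=> fK gK dX D0 cD [_ oW] cF F0 FW.
pose single (v : V) (x : X) : V := if f x == n then v else 0.
have vanish (k : X -> V) x : (forall y, F (f y) (k y)) -> (n <= f x)%N -> k x = 0.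
  by move=> Fk nx; have := Fk x; rewrite F0.
have cbox := @tychonoff X (fun=> V) (fun x => F (f x)) (fun x => cF (f x)).
pose L := [set x | (f x < n.+1)%N].
have cL : compact L.
  apply: finite_compact; apply: (sub_finite_set _ (finite_image g (finite_II n.+1))).
  by move=> x Lx; exists (f x).
pose P (v : V) (h : X -> V) := (forall x, F (f x) (h x)) -> W (h + single v).
have near0P : \forall v \near (0 : V), [set h | forall x, F (f x) (h x)] `<=` P v.
  apply: ((compact_near_coveringP _).1 cbox V (nbhs (0 : V)) P).
  move=> h Fh; have Lh : C_K L h.
    apply: C_K_closed; last first.
    - move=> x; rewrite /L /= => /negP; rewrite -leqNgt => nx.
      by have := Fh x; rewrite F0// ltnW.
    - exact: discrete_continuous.
    - by rewrite -openC; exact: discrete_open_set.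
  have [U [U0 UW]] := (oW L cL).2 h (conj (FW h Fh) Lh).
  have [U' U'0 U'U] := near0_addsub U0.
  have U'0' := nbhs_singleton U'0.
  (* On the box the coordinates from n on vanish, so a product neighbourhood restricting the first n
     coordinates controls h' - h uniformly. *)
  have hU' : nbhs (h : prod_topology (fun _ : X => V))
      (fun h' : X -> V => forall i : 'I_n, U' (h' (g i) - h (g i))).
    apply: (@filter_forall _ _ (fun (i : 'I_n) (h' : X -> V) => U' (h' (g i) - h (g i)))
      _ (nbhs_filter (h : prod_topology (fun _ : X => V)))) => i.
    apply: (@proj_continuous X (fun=> V) (g i) h [set u | U' (u - h (g i))]).
    apply/nbhs_translate; apply: filterS U'0 => u /=.
    by rewrite addrC addKr.
  exists ((fun h' : X -> V => forall i : 'I_n, U' (h' (g i) - h (g i))), U') => //.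
  move=> [h' v] /= [h'h U'v] Fh'.
  have [] // : (W `&` C_K L) (h' + single v).
  apply: UW; split.
    apply: C_K_closed; last first.
    - move=> x; rewrite /L /= => /negP; rewrite -leqNgt => nx.
      rewrite -[LHS]/(h' x + single v x) /single gtn_eqF// addr0.
      by have := Fh' x; rewrite F0// ltnW.
    - exact: discrete_continuous.
    - by rewrite -openC; exact: discrete_open_set.
  move=> x; rewrite -[X in U X]/(h' x + single v x - h x) /single addrAC.
  have [fx|fx|fx] := ltngtP (f x) n.
  - have := h'h (Ordinal fx); rewrite /= fK => H.
    by have [] := U'U _ _ H U'0'.
  - rewrite (vanish h' x Fh' (ltnW fx)) (vanish h x Fh (ltnW fx)) subrr addr0.
    exact: nbhs_singleton.
  - have nx : (n <= f x)%N by rewrite fx.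
    rewrite (vanish h' x Fh' nx) (vanish h x Fh nx) subrr add0r -[v]addr0.
    by have [] := U'U _ _ U'v U'0'.
(* A small dilate of the compact [D] fits into the neighbourhood just found and is still a compact
   neighbourhood of 0. *)
have [d d0 dP] := near0_absorbs_compact cD near0P.
have c0 : d / 2 != 0 by rewrite gt_eqF// divr_gt0.
exists [set v | D ((d / 2)^-1 *: v)]; split; first exact: near0_scale.
  rewrite (_ : [set v | _] = (fun v => (d / 2) *: v) @` D).
    apply: continuous_compact cD; apply: continuous_subspaceT.
    apply: (continuous_scale (c := fun=> d / 2 : K^o)); first by move=> v; exact: cst_continuous.
    by move=> v; exact: cvg_id.
  apply/seteqP; split => [v Dv|_ [v Dv <-]] /=.
    by exists ((d / 2)^-1 *: v) => //; rewrite scalerA divff// scale1r.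
  by rewrite scalerA mulVf// scale1r.
move=> h Eh; pose h' x := if f x == n then 0 else h x.
have Fh' x : F (f x) (h' x).
  by rewrite /h'; have := Eh x; case: eqP => [->|//] _; rewrite F0.
have -> : h = h' + single (h (g n)).
  apply/funext => x; rewrite -[RHS]/(h' x + single (h (g n)) x) /h' /single.
  by case: eqP => [<-|_]; rewrite ?fK ?add0r ?addr0.
have := Eh (g n); rewrite gK eqxx /= => /(dP (d / 2)).
rewrite scalerA divff// scale1r; apply => //.
by rewrite gtr0_norm ?divr_gt0// ltr_pdivrMr// ltr_pMr// ltr1n.
Qed.

(** From the box reduced to 0, coordinates are freed one at a time by [extend_compact_box], each
    factor staying compact. A function of compact support vanishes beyond some n, so it already lies
    in stage n. *)
Lemma compact_box_sub (K : numFieldType) (X : topologicalType)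
    (V : topologicalLmodType K) (f : X -> nat) (g : nat -> X) (D : set V)
    (W : set (X -> V)) :
    cancel f g -> cancel g f -> (forall x : X, open [set x]) ->
    nbhs 0 D -> compact D -> colim_open W -> W 0 ->
  exists2 E : nat -> set V, forall n, nbhs 0 (E n) &
    forall h, C_union h -> (forall x, E (f x) (h x)) -> W h.
Proof.
move=> fK gK dX D0 cD oW W0.
pose inv n (F : nat -> set V) := [/\ forall i, compact (F i),
  forall i, (n <= i)%N -> F i = [set 0] &
  forall h : X -> V, (forall x, F (f x) (h x)) -> W h].
pose ext (F : nat -> set V) n E i := if i == n then E else F i.
have step (q : nat * (nat -> set V)) : exists E, inv q.1 q.2 ->
    nbhs 0 E /\ inv q.1.+1 (ext q.2 q.1 E).
  case: q => n F /=; have [[cF F0 FW]|ninv] := pselect (inv n F); last by exists set0.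
  have [E [E0 cE EW]] := extend_compact_box fK gK dX D0 cD oW cF F0 FW.
  exists E => _; split => //; split => //.
    by move=> i; rewrite /ext; case: ifP.
  by move=> i ni; rewrite /ext gtn_eqF// F0// ltnW.
have [e eP] := choice step.
(* [S n] frees exactly the coordinates below n; [e] receives the whole previous stage because the
   size of the new factor depends on it. *)
pose S := fix S n := if n is m.+1 then ext (S m) m (e (m, S m)) else fun=> [set 0].
have invS n : inv n (S n).
  elim: n => [|n IH]; last by have [] := eP (n, S n) IH.
  split => [i|//|h h0]; first exact: compact_set1.
  by rewrite (_ : h = 0)//; apply/funext => x; exact: h0.
have SE n i : (i < n)%N -> S n i = e (i, S i).
  elim: n => // n IH; rewrite ltnS leq_eqVlt => /predU1P[->|ni] /=.
    by rewrite /ext eqxx.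
  by rewrite /ext ltn_eqF// IH.
exists (fun n => e (n, S n)) => [n|h [L [cL Lh]] hE]; first by have [] := eP (n, S n) (invS n).
have [||||_ [n _ <-] Ln] := @compact_sub_directed X L (range (fun n => [set x | (f x < n)%N])).
- by [].
- by exists [set x | (f x < 0)%N]; exists 0.
- move=> _ _ [n _ <-] [m _ <-]; exists [set x | (f x < maxn n m)%N]; first by exists (maxn n m).
  by move=> x /= [?|?]; rewrite leq_max; apply/orP; [left|right].
- move=> x _; exists [set y | (f y < (f x).+1)%N]; first by exists (f x).+1.
  by apply: open_nbhs_nbhs; split; [exact: discrete_open_set|rewrite /=].
have [_ S0 SW] := invS n; apply: SW => x.
have [xn|nx] := ltnP (f x) n; first by rewrite SE.
rewrite S0//; apply: (C_K_eq0 Lh) => /Ln /=.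
by rewrite ltnNge nx.
Qed.

(** After translation of [W] to 0, a box with factors [E n] lies in it; [E' n] with E' + E' inside E
    gives boxes around [f0] and [g0] whose sums lie in [W]. Interiors make these boxes open. *)
Lemma ACP_of_discrete_nat (K : numFieldType) (X : topologicalType)
    (V : topologicalLmodType K) :
    homeomorphic_to_discrete_nat X ->
    (exists2 D : set V, nbhs 0 D & compact D) -> ACP X V.
Proof.
move=> [f [g [fK [gK [cf cg]]]]] [D D0 cD].
have dX (x : X) : open [set x].
  rewrite (_ : [set x] = f @^-1` [set f x]).
    by apply: open_comp => [y _|]; [exact: cf|exact: discrete_open].
  by apply/seteqP; split => [y ->//|y /= /(can_inj fK)].
split; last by move=> W; exact: colim_open_opp.
move=> f0 g0 Cf Cg W oW Wfg.
have Cfg := C_unionD Cf Cg.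
have [|E E0 EW] := compact_box_sub fK gK dX D0 cD (colim_open_translate Cfg oW).
  by split; [exact: C_union0|rewrite add0r].
have [E' E'P] := choice (fun n => (exists2P _ _).1 (near0_addsub (E0 n))).
pose box (s : X -> V) := [set a : X -> V |
  C_union a /\ forall x, (E' (f x))^° (a x - s x)].
have box_self s : C_union s -> box s s.
  move=> Cs; split => // x; rewrite subrr; apply: nbhs_singleton.
  by apply: nbhs_interior; have [] := E'P (f x).
exists (box f0), (box g0); split.
- by apply: (@colim_open_box X V (fun x => (E' (f x))^°) f0 dX) => x; exact: open_interior.
- by apply: (@colim_open_box X V (fun x => (E' (f x))^°) g0 dX) => x; exact: open_interior.
- exact: box_self.
- exact: box_self.
- move=> a b [Ca ab] [Cb bb]; rewrite -[a + b](subrK (f0 + g0)).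
  have [] // := EW (a + b - (f0 + g0)).
    by apply: C_unionD; [exact: C_unionD|exact: C_unionN].
  move=> x; rewrite -[X in E _ X]/(a x + b x - (f0 x + g0 x)) opprD addrACA.
  have [_ E'E] := E'P (f x).
  by have [] := E'E _ _ (interior_subset (ab x)) (interior_subset (bb x)).
Qed.

(** * The equivalence over a scalar field with an embedding of the reals *)

Lemma ACP_iff (R : realType) (K : numFieldType) (iota : {rmorphism R -> K})
    (X : topologicalType) (V : topologicalLmodType K) :
    scalar_embedding iota -> hausdorff_space X -> locally_compact [set: X] ->
    metrizable R V -> (exists v : V, v != 0) ->
    (exists A : set X, [/\ regular_closed A, sigma_compact A & ~ compact A]) ->
  ACP X V <-> homeomorphic_to_discrete_nat X /\ finite_dimensional V.
Proof.
move=> iotaP hX lcX mV Vnt [A [rcA scA ncA]]; have hV := metrizable_hausdorff mV.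
have [_ _ _ disc] := iotaP; split => [acp|[homX fdV]]; last first.
  exact/ACP_of_discrete_nat/finite_dimensional_locally_compact.
have dX := ACP_discrete iotaP hX lcX mV Vnt rcA scA ncA acp.
split; last exact: ACP_finite_dimensional iotaP hX lcX mV Vnt rcA scA ncA acp.
apply: discrete_homeomorphic_nat => //.
  exact: ACP_discrete_countable iotaP hV Vnt dX acp.
by move=> finX; apply/ncA/finite_compact/(sub_finite_set _ finX).
Qed.

Theorem mainTheorem3 (R : realType) (K : numFieldType)
  (hK : K = (R : numFieldType) \/ K = ((complex R) : numFieldType))
  (X : topologicalType) (V : topologicalLmodType K) :
  hausdorff_space X -> locally_compact [set: X] ->
  metrizable R V -> (exists v : V, v != 0) ->
  (exists A : set X, [/\ regular_closed A, sigma_compact A & ~ compact A]) ->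
  (ACP X V <-> homeomorphic_to_discrete_nat X /\ finite_dimensional V).
Proof.
case: hK => KE; subst K.
  exact: (ACP_iff (scalar_embedding_real R)).
exact: (ACP_iff (scalar_embedding_complex R)).
Qed.
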